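(* Let $\Omega\subset\mathbb{C}$ be open and simply connected and let $F=\mathrm{e}^{\Phi+i\chi}$ and $F^\ast=\mathrm{e}^{\Phi^\ast+i\chi^\ast}$ be holomorphic functions on $\Omega$ (with $\Phi,\chi,\Phi^\ast,\chi^\ast$ real harmonic functions on $\Omega$). Let $\mathscr{S}$ and $\mathscr{S}^\ast$ be the minimal surfaces represented on $\Omega$ through the Weierstrass representation by $F$ and $F^\ast$, with parameterizations $\bm{r}$ and $\bm{r}^\ast$ respectively (so that they have the same system of normals: $\bm{\nu}^\ast(w)=\bm{\nu}(w)$ for all $w\in\Omega$). Then the deformation $\bm{y}:\mathscr{S}\to\mathscr{S}^\ast$ defined by $\bm{y}(\bm{r}(w))=\bm{r}^\ast(w)$ is bending-neutral, and $$\nabla_{\mathrm s}\bm{y}=\mathrm{e}^{\Phi^\ast-\Phi}\,\mathbf{R}_{\bm{\nu}}(\chi^\ast-\chi)\,\mathbf{P}(\bm{\nu}).$$ Thus any two minimal surfaces with the same spherical image are associated through a bending-neutral deformation.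
   Context: Weierstrass representation: a minimal surface whose unit normal, regarded as a map from the parameter domain $\Omega$ to the unit sphere $\mathbb{S}^2$, is injective and does not cover the whole of $\mathbb{S}^2$ is represented, to within a translation and in a suitable Cartesian frame $(\bm{e}_1,\bm{e}_2,\bm{e}_3)$, by a holomorphic nowhere vanishing function $F$ on the simply connected domain $\Omega$, with $w=u+iv\in\Omega$, as $$\bm{r}(w)=\Re\Big(\tfrac12\int(1-w^2)F(w)\,\mathrm{d}w\,\bm{e}_1+\tfrac{i}{2}\int(1+w^2)F(w)\,\mathrm{d}w\,\bm{e}_2+\int wF(w)\,\mathrm{d}w\,\bm{e}_3\Big).$$ The orientation is $\bm{\nu}=\bm{e}_u\times\bm{e}_v$, with $\bm{e}_u,\bm{e}_v$ the unit vectors of $\partial_u\bm{r},\partial_v\bm{r}$; then $\bm{\nu}=\frac{1}{u^2+v^2+1}\{2u\,\bm{e}_1+2v\,\bm{e}_2+(u^2+v^2-1)\bm{e}_3\}$, so $w$ is the stereographic projection of $\bm{\nu}$. The spherical image of a surface is the image of its normal map; two minimal surfaces whose unit normal maps are injective and do not cover the whole of $\mathbb{S}^2$, each represented by a holomorphic nowhere vanishing function through the Weierstrass representation, have the same spherical image precisely when they are represented, in the same frame, over the same $\Omega$. Surfaces are treated as parameterized (self-intersections are allowed and $\bm{y}$ is understood through the parameterization). $\mathbf{P}(\bm{\nu})=\mathbf{I}-\bm{\nu}\otimes\bm{\nu}$; $\nabla_{\mathrm s}\bm{y}$ is the differential of $\bm{y}$ along $\mathscr{S}$, extended by zero on $\bm{\nu}$;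 $\mathbf{R}_{\bm{\nu}}(\alpha)=\mathbf{I}+\sin\alpha\,\mathbf{W}(\bm{\nu})-(1-\cos\alpha)\mathbf{P}(\bm{\nu})$, with $\mathbf{W}(\bm{\nu})\bm{v}=\bm{\nu}\times\bm{v}$, is the rotation by $\alpha$ about $\bm{\nu}$. A deformation $\bm{y}$ of $\mathscr{S}$ has polar decomposition $\nabla_{\mathrm s}\bm{y}=\mathbf{R}_{\bm{y}}\mathbf{U}_{\bm{y}}$, where $\mathbf{R}_{\bm{y}}$ is a field of rotations and $\mathbf{U}_{\bm{y}}$ is symmetric, annihilates $\bm{\nu}$, and is positive definite from each tangent plane to itself; $\bm{y}$ is bending-neutral if $\mathbf{R}_{\bm{y}}$ is everywhere a rotation about $\bm{\nu}$. *)

(* Defs.v *)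
From HB Require Import structures.
From mathcomp Require Import all_boot all_order all_algebra.
From mathcomp Require Import all_classical all_reals all_analysis.
From mathcomp Require Import complex ring.

Set Implicit Arguments.
Unset Strict Implicit.
Unset Printing Implicit Defensive.

Import Order.TTheory GRing.Theory Num.Theory.
Import numFieldNormedType.Exports.

Local Open Scope classical_set_scope.
Local Open Scope ring_scope.
Local Open Scope complex_scope.

Local Notation Re := complex.Re.
Local Notation Im := complex.Im.

(* [R[i]] gets the topology and the normed-space structure (over itself) of an
   arbitrary [numFieldType], so that [derivable f w 1] and [is_derive w 1 f l]
   are complex differentiability of [f : R[i] -> R[i]]. *)
HB.instance Definition _ (R : rcfType) :=
  NormedModule.copy R[i] (R[i] : numFieldType)^o.

Section ComplexPlane.
Variable R : realType.
Implicit Types (Omega : set R[i]) (F h : R[i] -> R[i]) (phi : R[i] -> R).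

Definition holomorphic_on Omega F := forall w, Omega w -> derivable F w 1.

Definition cexp (z : R[i]) : R[i] :=
  (expR (Re z) * cos (Im z)) +i* (expR (Re z) * sin (Im z)).

(* Any two points are joined by a path, and any loop is contractible with fixed
   base point. *)
Definition simply_connected Omega :=
  (forall a b, Omega a -> Omega b ->
     exists g : R -> R[i], [/\ {within `[0, 1], continuous g},
       g 0 = a, g 1 = b & forall t, t \in `[0, 1] -> Omega (g t)]) /\
  (forall g : R -> R[i],
     {within `[0, 1], continuous g} -> g 0 = g 1 ->
     (forall t, t \in `[0, 1] -> Omega (g t)) ->
     exists H : R * R -> R[i],
       [/\ {within `[0, 1] `*` `[0, 1], continuous H},
           forall s t, s \in `[0, 1] -> t \in `[0, 1] -> Omega (H (s, t)),
           forall t, t \in `[0, 1] -> H (0, t) = g t,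
           forall t, t \in `[0, 1] -> H (1, t) = g 0 &
           forall s, s \in `[0, 1] -> H (s, 0) = g 0 /\ H (s, 1) = g 0]).

(* Real differential calculus on the plane goes through w = u + iv <-> (u, v). *)
Definition xy (w : R[i]) : R * R := (Re w, Im w).

Definition in_xy (V : Type) (G : R[i] -> V) : R * R -> V :=
  fun p => G (p.1 +i* p.2).

Definition partial_u (V : normedModType R) (G : R[i] -> V) (w : R[i]) : V :=
  'D_((1, 0) : R * R) (in_xy G) (xy w).

Definition partial_v (V : normedModType R) (G : R[i] -> V) (w : R[i]) : V :=
  'D_((0, 1) : R * R) (in_xy G) (xy w).

Definition C1_on Omega phi := forall w, Omega w ->
  [/\ differentiable (in_xy phi) (xy w),
      {for xy w, continuous (in_xy (partial_u phi))} &
      {for xy w, continuous (in_xy (partial_v phi))}].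

Definition harmonic_on Omega phi :=
  [/\ C1_on Omega phi, C1_on Omega (partial_u phi), C1_on Omega (partial_v phi) &
      forall w, Omega w ->
        partial_u (partial_u phi) w + partial_v (partial_v phi) w = 0].

Definition C1_diffeo Omega Omega' h :=
  exists k : R[i] -> R[i],
    [/\ forall w, Omega w -> Omega' (h w) /\ k (h w) = w,
        forall z, Omega' z -> Omega (k z) /\ h (k z) = z,
        C1_on Omega (fun w => Re (h w)) /\ C1_on Omega (fun w => Im (h w)) &
        C1_on Omega' (fun z => Re (k z)) /\ C1_on Omega' (fun z => Im (k z))].

End ComplexPlane.

Section EuclideanSpace.
Variable R : realType.
Implicit Types (a b nu v : 'cV[R]_3) (A Q U : 'M[R]_3) (e : 'I_3 -> 'cV[R]_3).

Definition dot a b : R := (a^T *m b) 0 0.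

Definition normalize v : 'cV[R]_3 := (Num.sqrt (dot v v))^-1 *: v.

(* Index arithmetic is in 'I_3, hence modulo 3. *)
Definition cross a b : 'cV[R]_3 :=
  \col_(i < 3) (a (i + 1) 0 * b (i + 2%:R) 0 - a (i + 2%:R) 0 * b (i + 1) 0).

Definition cartesian_frame e :=
  (forall i j, dot (e i) (e j) = (i == j)%:R) /\
  cross (e 0) (e 1) = e 2%:R.

Definition tangent_proj nu : 'M[R]_3 := 1%:M - nu *m nu^T.

Definition cross_mx nu : 'M[R]_3 :=
  \matrix_(i < 3, j < 3) cross nu (delta_mx j 0) i 0.

Lemma cross_mxE nu v : cross_mx nu *m v = cross nu v.
Proof.
apply/colP => i; rewrite !mxE !big_ord_recl big_ord0 !mxE.
have -> : lift ord0 ord0 = 1 :> 'I_3 by exact/val_inj.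
have -> : lift ord0 (lift ord0 ord0) = 2%:R :> 'I_3 by exact/val_inj.
have -> : ord0 = 0 :> 'I_3 by [].
suff : forall k : 'I_3, [\/ k = 0, k = 1 | k = 2%:R].
  have e2 : (1 + 1 : 'I_3) = 2%:R by [].
  have e3 : (1 + 2%:R : 'I_3) = 0 by exact/val_inj.
  have e4 : (2%:R + 1 : 'I_3) = 0 by exact/val_inj.
  have e5 : (2%:R + 2%:R : 'I_3) = 1 by exact/val_inj.
  by move=> /(_ i)[] ->; rewrite ?(add0r, e2, e3, e4, e5) !eqE /=; ring.
by case=> -[|[|[|//]]] ?; [apply: Or31|apply: Or32|apply: Or33]; exact/val_inj.
Qed.

Definition axis_rotation nu (alpha : R) : 'M[R]_3 :=
  1%:M + sin alpha *: cross_mx nu - (1 - cos alpha) *: tangent_proj nu.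

Definition is_rotation Q := Q^T *m Q = 1%:M /\ \det Q = 1.

Definition polar_decomposition nu A Q U :=
  [/\ A = Q *m U, is_rotation Q, U^T = U, U *m nu = 0 &
      forall v, dot v nu = 0 -> v != 0 -> 0 < dot v (U *m v)].

End EuclideanSpace.

Section Surfaces.
Variable R : realType.
Implicit Types (Omega : set R[i]) (F : R[i] -> R[i]).
Implicit Types (e : 'I_3 -> 'cV[R]_3) (r Y : R[i] -> 'cV[R]_3).

Definition unit_normal r (w : R[i]) : 'cV[R]_3 :=
  cross (normalize (partial_u r w)) (normalize (partial_v r w)).

Definition spherical_image Omega r : set 'cV[R]_3 := unit_normal r @` Omega.

(* The indefinite integrals are arbitrary primitives: their additive constants
   are the translation left free by the representation. *)
Definition weierstrass_representation e Omega F r :=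
  exists f1 f2 f3 : R[i] -> R[i], forall w, Omega w ->
    [/\ is_derive w 1 f1 (2%:R^-1 * (1 - w ^+ 2) * F w),
        is_derive w 1 f2 ('i / 2%:R * (1 + w ^+ 2) * F w),
        is_derive w 1 f3 (w * F w) &
        r w = Re (f1 w) *: e 0 + Re (f2 w) *: e 1 + Re (f3 w) *: e 2%:R].

(* The unit normal of such a surface is the inverse stereographic projection in
   the frame e, so it is injective and never equal to e 2; the frame is part of
   the existential data, so two such surfaces need not share it. *)
Definition weierstrass_surface Omega r :=
  [/\ open Omega, simply_connected Omega &
      exists e F,
        [/\ cartesian_frame e, holomorphic_on Omega F,
            forall w, Omega w -> F w != 0 &
            weierstrass_representation e Omega F r]].

(* A map y on the surface r is given by its expression Y = y o r in the
   parameter; A is the surface gradient of y at r w if A is zero on the normal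
   and dY = A dr at w, which is the chain rule. *)
Definition is_surface_gradient r Y (w : R[i]) (A : 'M[R]_3) :=
  [/\ differentiable (in_xy r) (xy w), differentiable (in_xy Y) (xy w),
      forall p : R * R, 'd (in_xy Y) (xy w) p = A *m 'd (in_xy r) (xy w) p &
      A *m unit_normal r w = 0].

Definition deformation Omega r Y := forall w, Omega w ->
  exists A Q U, is_surface_gradient r Y w A /\
                polar_decomposition (unit_normal r w) A Q U.

Definition bending_neutral Omega r Y :=
  deformation Omega r Y /\
  forall w A Q U, Omega w -> is_surface_gradient r Y w A ->
    polar_decomposition (unit_normal r w) A Q U ->
    exists alpha : R, Q = axis_rotation (unit_normal r w) alpha.

End Surfaces.

(* Main.v *)
Require Import Defs.
From HB Require Import structures.
From mathcomp Require Import all_boot all_order all_algebra.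
From mathcomp Require Import all_classical all_reals all_analysis.
From mathcomp Require Import complex.
From mathcomp Require Import ring lra.

Set Implicit Arguments.
Unset Strict Implicit.
Unset Printing Implicit Defensive.

Import Order.TTheory GRing.Theory Num.Theory.
Import numFieldNormedType.Exports.

Local Open Scope classical_set_scope.
Local Open Scope ring_scope.
Local Open Scope complex_scope.
Local Notation Re := complex.Re.
Local Notation Im := complex.Im.

(** A surface given by the Weierstrass representation in a frame [e] has, at
    [w], the partial derivatives [a] and [cross nu a], where [nu] is the inverse
    stereographic projection of [w] and [a] is real linear in the value [F w]:
    the parametrization is conformal, and multiplying [F w] by [i] turns the
    tangent plane by a right angle about [nu] ([weierstrass_conformal],
    [cross_sphere_point]).

    Hence if two such surfaces are parametrized over the same domain, one passes
    from the first differential to the second by multiplying [F w] by the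
    quotient [F* / F = exp (Phi* - Phi) exp (i (chi* - chi))], that is by
    scaling the tangent plane by [exp (Phi* - Phi)] and rotating it about [nu]
    by [chi* - chi]. This is the formula for the surface gradient. It is already
    a polar decomposition, and a polar decomposition is unique
    ([polar_conformal_mx_stretch], [polar_conformal_mx_rotation]), so every
    polar decomposition of the gradient has a rotation about [nu] as its
    orthogonal factor. This argument for bending-neutrality applies to any two
    conformal parametrizations with equal normals ([bending_neutral_conformal]).

    If the two surfaces only share their spherical image, their frames and
    domains may differ. Points with equal normals correspond through
    [transition], the stereographic projection in the second frame after the
    inverse stereographic projection in the first. It avoids the pole because
    the spherical image of each surface misses the pole of its own frame, its
    inverse is the transition in the opposite direction, and it is holomorphic
    with nonvanishing derivative since both frames are positively oriented
    ([transition_C1], [transition_du_neq0]). Composing the second surface with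
    it gives a conformal parametrization over the first domain with the same
    normals ([conformal_comp]), and the previous argument applies. *)

(** * Real differentials of complex differentiable functions *)

Section PlaneCalculus.
Variable R : realType.
Implicit Types (V W : normedModType R).

(** The little-o in the definition of a differential, spelled out with an
    explicit candidate: this is the form in which a complex estimate can be
    transferred to the real plane. *)
Lemma is_diff_le V W (g : V -> W) (x : V) (L : {linear V -> W}) :
  continuous L ->
  (forall e, 0 < e ->
     \forall h \near 0, `|g (h + x) - g x - L h| <= e * `|h|) ->
  is_diff x g L.
Proof.
move=> cL gL.
have gE : g \o shift x = cst (g x) + L +o_ 0 id.
  apply/eqaddoP => e e0; near=> h.
  rewrite /= !fctE opprD addrA; near: h; exact: gL.
have dL := diff_unique cL gE.
by apply: DiffDef => //; apply/diff_locallyP; rewrite dL.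
Unshelve. all: by end_near. Qed.

(** The Weierstrass formula for [r] is only known on the open set [Omega], so
    differentials have to be transported along local equality. *)
Lemma is_diff_near V W (g g' df : V -> W) (x : V) :
  (\forall y \near x, g y = g' y) -> is_diff x g df -> is_diff x g' df.
Proof.
move=> gg' dg.
have dfE : 'd g x = df :> (V -> W) by exact: diff_val.
rewrite -dfE; apply: is_diff_le => [|e e0]; first exact: diff_continuous.
have /eqaddoP/(_ e e0) := diff_locally (ex_diff (is_diff_def := dg)).
have E1 : \forall h \near 0, g (h + x) = g' (h + x).
  by move: gg'; rewrite (near_shift 0) subr0.
apply: filter_app; near=> h.
by rewrite /= !fctE opprD addrA (nbhs_singleton gg') (near E1 h).
Unshelve. all: by end_near. Qed.

(** Every differential on the parameter plane has this form, [a] and [b] being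
    the two partial derivatives. *)
Definition planar W (a b : W) (p : R * R) : W := p.1 *: a + p.2 *: b.

Fact planar_linear W (a b : W) : linear (planar a b).
Proof.
by move=> k u v; rewrite /planar /= !scalerDl scalerDr !scalerA addrACA.
Qed.
HB.instance Definition _ W (a b : W) :=
  GRing.isLinear.Build R (R * R)%type W _ (planar a b) (planar_linear a b).

Lemma planar_continuous W (a b : W) : continuous (planar a b).
Proof.
by move=> p; apply: cvgD; [exact: cvgZr_tmp cvg_fst|exact: cvgZr_tmp cvg_snd].
Qed.

(** A named equation, to be used through transitivity: rewriting under [mulmx]
    with an equation whose left-hand side is a linear map applied to a point
    sends unification astray. *)
Lemma diff_in_xy (Y : R[i] -> 'cV[R]_3) w a b p :
  is_diff (xy w) (in_xy Y) (planar a b) ->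
  'd (in_xy Y) (xy w) p = p.1 *: a + p.2 *: b.
Proof. by move=> dY; rewrite diff_val. Qed.

Definition toC (p : R * R) : R[i] := p.1 +i* p.2.

Lemma xyK (w : R[i]) : toC (xy w) = w. Proof. by case: w. Qed.

Lemma norm_Re_le (z : R[i]) : `|Re z| <= Re `|z|.
Proof. by rewrite normc_def /= -sqrtr_sqr ler_wsqrtr// lerDl sqr_ge0. Qed.

Lemma norm_toC (p : R * R) : `|toC p| <= (2 * `|p|)%:C.
Proof.
rewrite normc_def lecR /=.
have h1 : `|p.1| <= `|p| by rewrite le_max lexx.
have h2 : `|p.2| <= `|p| by rewrite le_max lexx orbT.
rewrite -(ger0_norm (_ : 0 <= 2 * `|p|)) ?mulr_ge0//.
rewrite -sqrtr_sqr ler_wsqrtr//.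
rewrite -[p.1 ^+ 2]ger0_norm ?sqr_ge0// -[p.2 ^+ 2]ger0_norm ?sqr_ge0// !normrX.
have := normr_ge0 p.1; have := normr_ge0 p.2; nra.
Qed.

Lemma toC_cvg (w : R[i]) : toC p @[p --> xy w] --> w.
Proof.
apply/cvgrPdist_lt => e.
rewrite ltcE /= => /andP[/eqP ime ree].
(* a positive element of [R[i]] is a positive real *)
have -> : e = (Re e)%:C by case: (e) ime => x y /= ->.
have near_w : \forall p \near xy w, `|xy w - p| < Re e / 2.
  have e2 : 0 < Re e / 2 by exact: divr_gt0.
  exact: (@cvgr_dist_lt _ (R * R)%type _ (nbhs (xy w)) _ id (xy w) cvg_id _ e2).
near=> p; have -> : w - toC p = toC (xy w - p) by case: (w).
apply: le_lt_trans (norm_toC _) _; rewrite ltcR mulrC -ltr_pdivlMr//.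
by near: p; exact: near_w.
Unshelve. all: by end_near. Qed.

(** With [l = f'(w)], the differential of [Re f] is
    [(du, dv) |-> Re (l * (du + i dv))]; the complex and the real remainder
    estimates agree because the Euclidean norm on [R[i]] and the sup norm on
    [R * R] are equivalent. *)
Lemma is_derive_is_diff_Re (f : R[i] -> R[i]) (w l : R[i]) :
  is_derive w 1 f l ->
  is_diff (xy w) (in_xy (fun z => Re (f z))) (planar (Re l) (- Im l)).
Proof.
move=> [df dfE]; apply: is_diff_le; first exact: planar_continuous.
move=> e e0.
have /eqaddoP/(_ (e / 2)%:C) := derivable_nbhs df.
rewrite ltcR divr_gt0// dfE => /(_ isT) H.
have := @toC_cvg (0 : R[i]) _ H.
move/(@filterS _ (nbhs (0 : (R * R)%type))); apply => p /=.
rewrite /= !fctE opprD addrA => Hp.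
have -> : in_xy (fun z => Re (f z)) (p + xy w)
    - in_xy (fun z => Re (f z)) (xy w) - planar (Re l) (- Im l) p =
    Re (f (toC p *: 1 + w) - f w - toC p *: l).
  rewrite /in_xy /planar /xy /=.
  have -> : toC p *: 1 + w = (p.1 + Re w) +i* (p.2 + Im w).
    by rewrite /toC; case: (w) => x y /=; rewrite [_ *: _]mulr1.
  have -> : Re w +i* Im w = w by case: (w).
  case: (f _) => x1 y1; case: (f _) => x2 y2; case: (l) => c d /=.
  by rewrite /GRing.scale /=; ring.
apply: le_trans (norm_Re_le _) _.
have := le_trans Hp (ler_wpM2l _ (norm_toC p)).
rewrite lecR divr_ge0 ?(ltW e0)// => /(_ isT).
rewrite normc_def -rmorphM lecR /=.
by rewrite mulrA divfK ?pnatr_eq0.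
Unshelve. all: by end_near. Qed.

End PlaneCalculus.

(** * Vector algebra in three dimensions *)

Section VectorAlgebra.
Variable R : realType.
Implicit Types (a b c nu v : 'cV[R]_3) (A Q U : 'M[R]_3).

Lemma ord3P (P : 'I_3 -> Prop) : P 0 -> P 1 -> P 2%:R -> forall i, P i.
Proof.
move=> P0 P1 P2 [[|[|[|//]]] i].
- by have <- : 0 = Ordinal i by exact/val_inj.
- by have <- : 1 = Ordinal i by exact/val_inj.
- by have <- : 2%:R = Ordinal i by exact/val_inj.
Qed.

Lemma sum3 (f : 'I_3 -> R) : \sum_i f i = f 0 + f 1 + f 2%:R.
Proof.
rewrite !big_ord_recl big_ord0 addr0 addrA.
by congr (f _ + f _ + f _); exact/val_inj.
Qed.

Lemma dotE a b : dot a b = a 0 0 * b 0 0 + a 1 0 * b 1 0 + a 2%:R 0 * b 2%:R 0.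
Proof. by rewrite /dot mxE sum3 !mxE. Qed.

Lemma crossE a b :
  (cross a b 0 0 = a 1 0 * b 2%:R 0 - a 2%:R 0 * b 1 0) *
  (cross a b 1 0 = a 2%:R 0 * b 0 0 - a 0 0 * b 2%:R 0) *
  (cross a b 2%:R 0 = a 0 0 * b 1 0 - a 1 0 * b 0 0).
Proof.
have e1 : (1 + 1 : 'I_3) = 2%:R by [].
have e2 : (1 + 2%:R : 'I_3) = 0 by exact/val_inj.
have e3 : (2%:R + 1 : 'I_3) = 0 by exact/val_inj.
have e4 : (2%:R + 2%:R : 'I_3) = 1 by exact/val_inj.
by rewrite !mxE !add0r e1 e2 e3 e4.
Qed.

Lemma col3P a b :
  a 0 0 = b 0 0 -> a 1 0 = b 1 0 -> a 2%:R 0 = b 2%:R 0 -> a = b.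
Proof. by move=> h0 h1 h2; apply/colP; apply: ord3P. Qed.

Lemma det3E A : \det A =
  A 0 0 * (A 1 1 * A 2%:R 2%:R - A 1 2%:R * A 2%:R 1)
  - A 0 1 * (A 1 0 * A 2%:R 2%:R - A 1 2%:R * A 2%:R 0)
  + A 0 2%:R * (A 1 0 * A 2%:R 1 - A 1 1 * A 2%:R 0).
Proof.
rewrite (expand_det_row _ 0) sum3 /cofactor.
have d2 (B : 'M[R]_2) : \det B = B 0 0 * B 1 1 - B 0 1 * B 1 0.
  rewrite (expand_det_row _ 0) !big_ord_recl big_ord0 addr0 /cofactor.
  rewrite !det_mx11 !mxE /= expr0 expr1 mul1r mulN1r mulrN.
  by congr (B _ _ * B _ _ - B _ _ * B _ _); exact/val_inj.
rewrite !d2 !mxE /=.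
have e01 : lift 0 (0 : 'I_2) = 1 :> 'I_3 by exact/val_inj.
have e02 : lift 0 (1 : 'I_2) = 2%:R :> 'I_3 by exact/val_inj.
have e11 : lift 1 (0 : 'I_2) = 0 :> 'I_3 by exact/val_inj.
have e12 : lift 1 (1 : 'I_2) = 2%:R :> 'I_3 by exact/val_inj.
have e21 : lift 2%:R (0 : 'I_2) = 0 :> 'I_3 by exact/val_inj.
have e22 : lift 2%:R (1 : 'I_2) = 1 :> 'I_3 by exact/val_inj.
by rewrite e01 e02 e11 e12 e21 e22 /=; ring.
Qed.

Lemma mulmx3E A v i :
  (A *m v) i 0 = A i 0 * v 0 0 + A i 1 * v 1 0 + A i 2%:R * v 2%:R 0.
Proof. by rewrite mxE sum3. Qed.

Lemma scale_coord (k : R) a i : (k *: a) i 0 = k * a i 0.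
Proof. by rewrite mxE. Qed.
Lemma add_coord a b i : (a + b) i 0 = a i 0 + b i 0. Proof. by rewrite mxE. Qed.
Lemma opp_coord a i : (- a) i 0 = - a i 0. Proof. by rewrite mxE. Qed.
Lemma zero_coord i : (0 : 'cV[R]_3) i 0 = 0. Proof. by rewrite mxE. Qed.
Definition vecE := (scale_coord, add_coord, opp_coord, zero_coord).

Lemma trE A i j : A^T i j = A j i. Proof. by rewrite mxE. Qed.

Definition coordE := (dotE, crossE, vecE).

(** The cofactor identity; for rotations it says that they commute with the
    cross product. *)
Lemma cross_mulmx A a b : A^T *m cross (A *m a) (A *m b) = \det A *: cross a b.
Proof.
apply: col3P; rewrite mulmx3E vecE !trE !crossE !mulmx3E det3E; ring.
Qed.

Lemma cross_cross nu a :
  cross nu (cross nu a) = dot nu a *: nu - dot nu nu *: a.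
Proof. by apply: col3P; rewrite !coordE; ring. Qed.

Lemma cross_crossr nu a :
  cross a (cross nu a) = dot a a *: nu - dot nu a *: a.
Proof. by apply: col3P; rewrite !coordE; ring. Qed.

Lemma dot_crossl nu a : dot nu (cross nu a) = 0.
Proof. by rewrite !coordE; ring. Qed.

Lemma dot_crossr nu a : dot a (cross nu a) = 0.
Proof. by rewrite !coordE; ring. Qed.

Lemma crossvv a : cross a a = 0.
Proof. by apply: col3P; rewrite !coordE; ring. Qed.

Lemma crossZZ (k l : R) a b : cross (k *: a) (l *: b) = (k * l) *: cross a b.
Proof. by apply: col3P; rewrite !coordE; ring. Qed.

Lemma dot_cross_cross nu a :
  dot (cross nu a) (cross nu a) = dot nu nu * dot a a - dot nu a ^+ 2.
Proof. by rewrite !coordE; ring. Qed.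

Lemma dotC a b : dot a b = dot b a.
Proof. by rewrite !coordE; ring. Qed.

Lemma dot_ge0 a : 0 <= dot a a.
Proof. by rewrite coordE -!expr2 !addr_ge0 ?sqr_ge0. Qed.

Lemma dot_eq0 a : dot a a = 0 -> a = 0.
Proof.
rewrite coordE -!expr2 => h.
have h0 := sqr_ge0 (a 0 0); have h1 := sqr_ge0 (a 1 0).
have h2 := sqr_ge0 (a 2%:R 0).
by apply: col3P; rewrite vecE; apply/eqP; rewrite -sqrf_eq0; apply/eqP; lra.
Qed.

Lemma dot_gt0 a : a != 0 -> 0 < dot a a.
Proof.
by move=> a0; rewrite lt_def dot_ge0 andbT; apply: contra_neq a0 => /dot_eq0.
Qed.

Lemma dotmxr A a b : dot (A *m a) b = dot a (A^T *m b).
Proof. by rewrite /dot trmx_mul mulmxA. Qed.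

Lemma dotZr k a b : dot a (k *: b) = k * dot a b.
Proof. by rewrite !coordE; ring. Qed.
Lemma dotDr v a b : dot v (a + b) = dot v a + dot v b.
Proof. by rewrite !coordE; ring. Qed.
Lemma dot0r v : dot v 0 = 0.
Proof. by rewrite !coordE; ring. Qed.

(** Cramer's rule for the triple [nu, a, nu x a]: it is an orthogonal basis as
    soon as [nu] is a unit vector orthogonal to [a] and [a] is nonzero. *)
Lemma cramer3 a nu v :
  (dot nu nu * dot a a - dot nu a ^+ 2) *: v =
  dot v (cross a (cross nu a)) *: nu - dot v (cross nu (cross nu a)) *: a
  + dot v (cross nu a) *: cross nu a.
Proof. by apply: col3P; rewrite !coordE; ring. Qed.

(** Then [nu, a, cross nu a] is a positively oriented orthogonal basis: [nu]
    will be the normal of a surface and [a, cross nu a] its two partial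
    derivatives. *)
Definition oriented_frame nu a :=
  [/\ dot nu nu = 1, dot nu a = 0 & a != 0].

Lemma mx_eq0_frame nu a A : oriented_frame nu a ->
  A *m nu = 0 -> A *m a = 0 -> A *m cross nu a = 0 -> A = 0.
Proof.
move=> [n1 na a0] An Aa Ab.
have Av v : A *m v = 0.
  have := congr1 (mulmx A) (cramer3 a nu v).
  rewrite mulmxDr mulmxBr -!scalemxAr An Aa Ab !scaler0 subr0 addr0.
  rewrite n1 na mul1r expr0n subr0 => /eqP.
  by rewrite scaler_eq0 gt_eqF ?dot_gt0//= => /eqP.
apply/matrixP => i j.
have := congr1 (fun v : 'cV_3 => v i 0) (Av (delta_mx j 0)).
by rewrite -colE !mxE.
Qed.

Lemma mx_eq_mulmx A B : (forall v, A *m v = B *m v) -> A = B.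
Proof.
move=> AB; apply/matrixP => i j.
have := congr1 (fun v : 'cV_3 => v i 0) (AB (delta_mx j 0)).
by rewrite -!colE !mxE.
Qed.

Lemma adjoint_tr A B : (forall a b, dot (A *m a) b = dot a (B *m b)) -> A^T = B.
Proof.
move=> AB; apply: mx_eq_mulmx => v; apply/eqP; rewrite -subr_eq0; apply/eqP.
apply: dot_eq0; set z := _ - _.
rewrite {2}/z dotDr -scaleN1r dotZr -dotmxr AB; ring.
Qed.

Lemma crossDr nu a b : cross nu (a + b) = cross nu a + cross nu b.
Proof. by apply: col3P; rewrite !coordE; ring. Qed.

Lemma crossZr nu k a : cross nu (k *: a) = k *: cross nu a.
Proof. by apply: col3P; rewrite !coordE; ring. Qed.

(** * Rotations about an axis and polar decomposition *)

Lemma tangent_projE nu v : tangent_proj nu *m v = v - dot nu v *: nu.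
Proof.
rewrite mulmxBl mul1mx -mulmxA; congr (_ - _).
by rewrite [nu^T *m v]mx11_scalar mul_mx_scalar.
Qed.

Lemma tangent_proj_normal nu : dot nu nu = 1 -> tangent_proj nu *m nu = 0.
Proof. by move=> n1; rewrite tangent_projE n1 scale1r subrr. Qed.

Lemma tangent_proj_tangent nu v : dot nu v = 0 -> tangent_proj nu *m v = v.
Proof. by move=> nv; rewrite tangent_projE nv scale0r subr0. Qed.

Lemma tr_tangent_proj nu : (tangent_proj nu)^T = tangent_proj nu.
Proof. by apply: adjoint_tr => a b; rewrite !tangent_projE !coordE; ring. Qed.

Lemma tangent_proj_idem nu :
  dot nu nu = 1 -> tangent_proj nu *m tangent_proj nu = tangent_proj nu.
Proof.
move=> n1; apply: mx_eq_mulmx => v; rewrite -mulmxA tangent_proj_tangent//.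
by rewrite tangent_projE dotDr -scaleN1r !dotZr n1; ring.
Qed.

(** Rodrigues' rotation formula. *)
Lemma axis_rotationE nu t v : axis_rotation nu t *m v =
  cos t *: v + sin t *: cross nu v + ((1 - cos t) * dot nu v) *: nu.
Proof.
rewrite /axis_rotation mulmxBl mulmxDl mul1mx -!scalemxAl tangent_projE.
by rewrite cross_mxE; apply: col3P; rewrite !vecE; ring.
Qed.

Lemma axis_rotationD nu s t : dot nu nu = 1 ->
  axis_rotation nu (s + t) = axis_rotation nu s *m axis_rotation nu t.
Proof.
move=> n1; apply: mx_eq_mulmx => v; rewrite -mulmxA !axis_rotationE.
rewrite !(crossDr, crossZr, cross_cross, crossvv, dotDr, dotZr, dot_crossl) n1.
by rewrite sinD cosD; apply: col3P; rewrite !vecE; ring.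
Qed.

Lemma axis_rotation0 nu : axis_rotation nu 0 = 1%:M.
Proof.
by rewrite /axis_rotation sin0 cos0 subrr !scale0r addr0 subr0.
Qed.

Lemma tr_axis_rotation nu t : (axis_rotation nu t)^T = axis_rotation nu (- t).
Proof.
apply: adjoint_tr => a b; rewrite !axis_rotationE sinN cosN.
by rewrite !coordE; ring.
Qed.

(** The determinant needs no expansion: [R(t) = R(t/2) R(t/2)] and
    [R(t/2)] is orthogonal. *)
Lemma axis_rotation_is_rotation nu t :
  dot nu nu = 1 -> is_rotation (axis_rotation nu t).
Proof.
move=> n1.
have tQ s : (axis_rotation nu s)^T *m axis_rotation nu s = 1%:M.
  by rewrite tr_axis_rotation -axis_rotationD// addNr axis_rotation0.
split=> //; rewrite [t]splitr axis_rotationD// det_mulmx.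
by have := congr1 determinant (tQ (t / 2)); rewrite det_mulmx det_tr det1.
Qed.

Lemma axis_rotation_tangent nu t a : dot nu a = 0 ->
  axis_rotation nu t *m a = cos t *: a + sin t *: cross nu a.
Proof. by move=> na; rewrite axis_rotationE na mulr0 scale0r addr0. Qed.

Lemma rotation_cross Q a b :
  is_rotation Q -> Q *m cross a b = cross (Q *m a) (Q *m b).
Proof.
move=> [QQ dQ]; have := congr1 (mulmx Q) (cross_mulmx Q a b).
by rewrite dQ scale1r mulmxA (mulmx1C QQ) mul1mx.
Qed.

(** The surface gradient of a bending-neutral deformation between minimal
    surfaces: a rotation by [t] in the tangent plane, scaled by [lam]. *)
Definition conformal_mx nu (lam t : R) : 'M[R]_3 :=
  lam *: (axis_rotation nu t *m tangent_proj nu).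

Lemma polar_conformal_mx nu lam t : dot nu nu = 1 -> 0 < lam ->
  polar_decomposition nu (conformal_mx nu lam t) (axis_rotation nu t)
    (lam *: tangent_proj nu).
Proof.
move=> n1 lam0; split.
- by rewrite /conformal_mx scalemxAr.
- exact: axis_rotation_is_rotation.
- by rewrite linearZ /= tr_tangent_proj.
- by rewrite -scalemxAl tangent_proj_normal// scaler0.
- move=> v; rewrite dotC => nv v0.
  rewrite -scalemxAl tangent_proj_tangent// dotZr.
  by rewrite mulr_gt0// dot_gt0.
Qed.

(** From [A = Q U] one gets [U U = A^T A = lam^2 P]. For any [v], the vector
    [z = U v - lam P v] is tangent and satisfies [U z = - lam z], which is
    incompatible with the positivity of [U] on the tangent plane unless
    [z = 0]. *)
Lemma polar_conformal_mx_stretch nu lam t Q U :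
  dot nu nu = 1 -> 0 < lam ->
  polar_decomposition nu (conformal_mx nu lam t) Q U ->
  U = lam *: tangent_proj nu.
Proof.
move=> n1 lam0 [AE [QQ _] Ut Un Upos].
have UU : U *m U = (lam ^+ 2) *: tangent_proj nu.
  have -> : U *m U = (Q *m U)^T *m (Q *m U).
    by rewrite trmx_mul Ut mulmxA -(mulmxA U) QQ mulmx1.
  rewrite -AE /conformal_mx [(_ *: _)^T]linearZ /= trmx_mul tr_tangent_proj.
  rewrite -scalemxAl -scalemxAr scalerA -expr2; congr (_ *: _).
  rewrite mulmxA -(mulmxA (tangent_proj nu)).
  have [-> _] := axis_rotation_is_rotation t n1.
  by rewrite mulmx1 tangent_proj_idem.
have UP : U *m tangent_proj nu = U.
  apply: mx_eq_mulmx => v.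
  by rewrite -mulmxA tangent_projE mulmxBr -scalemxAr Un scaler0 subr0.
apply: mx_eq_mulmx => v; set D := _ *: _.
apply/eqP; rewrite -subr_eq0; set z := _ - _; apply/negP => z0.
have zn : dot z nu = 0.
  have nU : dot nu (U *m v) = 0 by rewrite -[U]Ut -dotmxr Un dotC dot0r.
  have nP : dot nu (tangent_proj nu *m v) = 0.
    rewrite -[tangent_proj nu]tr_tangent_proj -dotmxr tangent_proj_normal//.
    by rewrite dotC dot0r.
  by rewrite dotC /z dotDr nU -scaleN1r dotZr /D -scalemxAl dotZr nP; ring.
have Uz : U *m z = - lam *: z.
  rewrite /z /D mulmxBr mulmxA UU -!scalemxAl -scalemxAr.
  rewrite [U *m (_ *m _)]mulmxA UP.
  by apply: col3P; rewrite !vecE; ring.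
have := Upos z zn; rewrite Uz dotZr => /(_ (introN idP z0)).
have := mulr_ge0 (ltW lam0) (dot_ge0 z); lra.
Qed.

(** Once the stretch is known, [Q] and [R(t)] agree on the tangent plane. Both
    preserve the cross product, and [nu] is, up to a nonzero factor, the cross
    product of two tangent vectors, so they agree on [nu] as well. *)
Lemma polar_conformal_mx_rotation nu a lam t Q U :
  oriented_frame nu a -> 0 < lam ->
  polar_decomposition nu (conformal_mx nu lam t) Q U ->
  Q = axis_rotation nu t.
Proof.
move=> fr lam0 pol; have [n1 na a0] := fr.
have UE := polar_conformal_mx_stretch n1 lam0 pol.
have [AE rQ _ _ _] := pol.
have rR := axis_rotation_is_rotation t n1.
have QR v : dot nu v = 0 -> Q *m v = axis_rotation nu t *m v.
  move=> nv; have := congr1 (fun M => M *m v) AE.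
  rewrite UE /conformal_mx -scalemxAr -!scalemxAl -!mulmxA.
  by rewrite tangent_proj_tangent// => /(scalerI (lt0r_neq0 lam0)) ->.
have Qn : Q *m nu = axis_rotation nu t *m nu.
  have := rotation_cross a (cross nu a) rQ.
  rewrite (QR a na) (QR _ (dot_crossl nu a)) -rotation_cross//.
  rewrite cross_crossr na scale0r subr0.
  by rewrite -!scalemxAr => /(scalerI (lt0r_neq0 (dot_gt0 a0))).
apply/eqP; rewrite -subr_eq0; apply/eqP.
by apply: (mx_eq0_frame fr); rewrite mulmxBl ?Qn ?QR ?dot_crossl// subrr.
Qed.

Lemma conformal_mx_normal nu lam t :
  dot nu nu = 1 -> conformal_mx nu lam t *m nu = 0.
Proof.
move=> n1; rewrite /conformal_mx -scalemxAl -mulmxA tangent_proj_normal//.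
by rewrite mulmx0 scaler0.
Qed.

Lemma conformal_mx_tangent nu lam t a : dot nu a = 0 ->
  conformal_mx nu lam t *m a =
  lam * cos t *: a + lam * sin t *: cross nu a.
Proof.
move=> na; rewrite /conformal_mx -scalemxAl -mulmxA tangent_proj_tangent//.
by rewrite axis_rotation_tangent// scalerDr !scalerA.
Qed.

Lemma normalize_frame nu a : oriented_frame nu a ->
  cross (normalize a) (normalize (cross nu a)) = nu.
Proof.
move=> [n1 na a0]; have a_gt0 := dot_gt0 a0.
rewrite /normalize dot_cross_cross n1 na mul1r expr0n subr0 crossZZ.
rewrite cross_crossr na scale0r subr0 scalerA -invfM -expr2.
by rewrite sqr_sqrtr ?ltW// mulVf ?gt_eqF// scale1r.
Qed.

Lemma polar_coordinates (x y : R) : (x != 0) || (y != 0) ->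
  exists lam t, [/\ 0 < lam, x = lam * cos t & y = lam * sin t].
Proof.
move=> xy0; pose l2 := x ^+ 2 + y ^+ 2.
have l2_gt0 : 0 < l2.
  rewrite lt_def addr_ge0 ?sqr_ge0// andbT paddr_eq0 ?sqr_ge0// !sqrf_eq0.
  by rewrite negb_and.
pose lam := Num.sqrt l2; have lam_gt0 : 0 < lam by rewrite sqrtr_gt0.
have lam2 : lam ^+ 2 = l2 by rewrite sqr_sqrtr// ltW.
have xl : -1 <= x / lam <= 1.
  rewrite -ler_norml normrM normfV (gtr0_norm lam_gt0) ler_pdivrMr// mul1r.
  rewrite -ler_sqr ?nnegrE ?(ltW lam_gt0)// real_normK ?num_real// lam2.
  by rewrite lerDl sqr_ge0.
have ly : lam ^+ 2 * (1 - (x / lam) ^+ 2) = y ^+ 2.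
  have -> : lam ^+ 2 * (1 - (x / lam) ^+ 2) = lam ^+ 2 - x ^+ 2.
    by field; rewrite gt_eqF.
  by rewrite lam2 /l2; ring.
have ay : lam * Num.sqrt (1 - (x / lam) ^+ 2) = `|y|.
  rewrite -[X in X * _ = _]ger0_norm ?(ltW lam_gt0)// -sqrtr_sqr.
  by rewrite -sqrtrM ?sqr_ge0// ly sqrtr_sqr.
have xE : x = lam * (x / lam) by rewrite mulrC divfK// gt_eqF.
have [y0|y0] := leP 0 y.
  exists lam, (acos (x / lam)); split=> //; first by rewrite acosK.
  by rewrite sin_acos// ay ger0_norm.
exists lam, (- acos (x / lam)); split=> //; first by rewrite cosN acosK.
by rewrite sinN sin_acos// mulrN ay ltr0_norm// opprK.
Qed.

End VectorAlgebra.

(** * Conformal parametrizations and bending-neutrality *)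

Section Surfaces.
Variable R : realType.
Implicit Types (Omega : set R[i]) (F : R[i] -> R[i]) (w c : R[i]).
Implicit Types (e : 'I_3 -> 'cV[R]_3) (r Y : R[i] -> 'cV[R]_3).
Implicit Types (a b nu : 'cV[R]_3) (A Q U : 'M[R]_3).

(** The parametrization is conformal and positively oriented at [w]: its
    partial derivatives are [a] and [cross nu a]. *)
Definition conformal_at r w nu a :=
  oriented_frame nu a /\ is_diff (xy w) (in_xy r) (planar a (cross nu a)).

Lemma unit_normal_conformal r w nu a :
  conformal_at r w nu a -> unit_normal r w = nu.
Proof.
move=> [fr [dr rE]]; rewrite /unit_normal /partial_u /partial_v.
rewrite !deriveE// rE /planar /= !scale1r !scale0r addr0 add0r.
exact: normalize_frame.
Qed.

(** A linear map that commutes with [cross nu _] on the tangent plane is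
    determined there by the image of [a]. *)
Lemma surface_gradient_conformal r Y w nu a lam t :
  conformal_at r w nu a ->
  conformal_at Y w nu (lam * cos t *: a + lam * sin t *: cross nu a) ->
  is_surface_gradient r Y w (conformal_mx nu lam t).
Proof.
move=> cr [_ dY]; have [[n1 na a0] dr] := cr.
split; [exact: ex_diff|exact: ex_diff| |]; last first.
  by rewrite (unit_normal_conformal cr) conformal_mx_normal.
move=> p; apply: (etrans (diff_in_xy p dY)).
apply: esym; apply: (etrans (congr1 (mulmx _) (diff_in_xy p dr))).
rewrite mulmxDr -!scalemxAr.
rewrite !conformal_mx_tangent ?dot_crossl//.
by rewrite crossDr !crossZr.
Qed.

Lemma surface_gradient_unique r Y w nu a A A' :
  conformal_at r w nu a ->
  is_surface_gradient r Y w A -> is_surface_gradient r Y w A' -> A = A'.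
Proof.
move=> cr; have [fr dr] := cr.
move=> [_ _ AE An] [_ _ AE' An'].
rewrite (unit_normal_conformal cr) in An An'.
have AA (p : R * R) :
    A *m (p.1 *: a + p.2 *: cross nu a) = A' *m (p.1 *: a + p.2 *: cross nu a).
  have rE := diff_in_xy p dr.
  apply: (etrans (congr1 (mulmx A) (esym rE))).
  by apply: (etrans (esym (AE p))); apply: (etrans (AE' p)); apply: congr1.
apply/eqP; rewrite -subr_eq0; apply/eqP; apply: (mx_eq0_frame fr).
- by rewrite mulmxBl An An' subrr.
- have := AA (1, 0); rewrite /= scale1r scale0r addr0 mulmxBl => ->.
  by rewrite subrr.
- have := AA (0, 1); rewrite /= scale1r scale0r add0r mulmxBl => ->.
  by rewrite subrr.
Qed.

(** In the tangent plane, oriented by [nu], [cross nu _] plays the role of the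
    imaginary unit; this is the polar form of the quotient [b / a]. *)
Lemma tangent_polar nu a b : oriented_frame nu a -> oriented_frame nu b ->
  exists lam t,
    0 < lam /\ b = lam * cos t *: a + lam * sin t *: cross nu a.
Proof.
move=> [n1 na a0] [_ nb b0]; have aa0 := dot_gt0 a0.
pose x := dot b a / dot a a; pose y := dot b (cross nu a) / dot a a.
have bE : b = x *: a + y *: cross nu a.
  apply: (scalerI (lt0r_neq0 aa0)); have := cramer3 a nu b.
  rewrite n1 na mul1r expr0n subr0 => ->.
  rewrite cross_cross cross_crossr na n1 !scale0r !subr0 sub0r scale1r.
  rewrite dotZr dotC nb mulr0 scale0r add0r.
  rewrite scalerDr !scalerA /x /y !(mulrC (dot a a)) !divfK ?gt_eqF//.
  have -> : dot b (- a) = - dot b a by rewrite !coordE; ring.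
  by rewrite scaleNr opprK.
have /polar_coordinates [lam [t [l0 xE yE]]] : (x != 0) || (y != 0).
  rewrite -negb_and; apply: contra b0 => /andP[/eqP x0 /eqP y0].
  by rewrite bE x0 y0 !scale0r addr0.
by exists lam, t; split=> //; rewrite -xE -yE.
Qed.

(** The geometric core of both assertions: two conformal parametrizations with
    the same normal at every parameter value differ, to first order, by a
    similarity of the common tangent plane, whose rotational part is a rotation
    about the normal. *)
Lemma bending_neutral_conformal Omega r Y :
  (forall w, Omega w -> exists nu a b,
     conformal_at r w nu a /\ conformal_at Y w nu b) ->
  bending_neutral Omega r Y.
Proof.
move=> rY.
have grad w : Omega w -> exists nu a lam t, [/\ conformal_at r w nu a, 0 < lam &
    is_surface_gradient r Y w (conformal_mx nu lam t)].
  move=> /rY[nu [a [b [cr cY]]]].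
  have [lam [t [l0 bE]]] := tangent_polar cr.1 cY.1.
  exists nu, a, lam, t; split=> //; apply: (surface_gradient_conformal cr).
  by rewrite -bE.
split=> [w /grad|w A Q U /grad].
  move=> [nu [a [lam [t [cr l0 gr]]]]].
  exists (conformal_mx nu lam t), (axis_rotation nu t).
  exists (lam *: tangent_proj nu).
  split=> //; rewrite (unit_normal_conformal cr).
  by apply: polar_conformal_mx => //; have [[]] := cr.
move=> [nu [a [lam [t [cr l0 gr]]]]] gA.
rewrite (surface_gradient_unique cr gA gr) (unit_normal_conformal cr) => pol.
exists t; exact: polar_conformal_mx_rotation cr.1 l0 pol.
Qed.

(** * The tangent plane in the Weierstrass representation *)

Definition frame_comb e (x y z : R) := x *: e 0 + y *: e 1 + z *: e 2%:R.

Lemma dot_frame_comb e x y z x' y' z' : cartesian_frame e ->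
  dot (frame_comb e x y z) (frame_comb e x' y' z') = x * x' + y * y' + z * z'.
Proof.
move=> [oe _].
rewrite /frame_comb !dotDr !dotZr ![dot (_ + _) _]dotC !dotDr !dotZr !oe.
rewrite !eqE /=; ring.
Qed.

Lemma cross_frame_comb e x y z x' y' z' : cartesian_frame e ->
  cross (frame_comb e x y z) (frame_comb e x' y' z') =
  frame_comb e (y * z' - z * y') (z * x' - x * z') (x * y' - y * x').
Proof.
move=> [oe c01].
have c12 : cross (e 1) (e 2%:R) = e 0.
  by rewrite -c01 cross_crossr !oe scale1r scale0r subr0.
have c02 : cross (e 0) (e 2%:R) = - e 1.
  by rewrite -c01 cross_cross !oe scale1r scale0r sub0r.
have E : cross (frame_comb e x y z) (frame_comb e x' y' z') =
  (y * z' - z * y') *: cross (e 1) (e 2%:R) +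
  - (z * x' - x * z') *: cross (e 0) (e 2%:R) +
  (x * y' - y * x') *: cross (e 0) (e 1).
  by rewrite /frame_comb; apply: col3P; rewrite !coordE; ring.
by rewrite E c12 c02 c01 scalerN scaleNr opprK.
Qed.

Lemma frame_combK e v : cartesian_frame e ->
  frame_comb e (dot v (e 0)) (dot v (e 1)) (dot v (e 2%:R)) = v.
Proof.
move=> [oe c01]; have := cramer3 (e 1) (e 0) v.
rewrite cross_cross cross_crossr c01 !oe /= !scale0r !subr0 sub0r !scale1r.
rewrite mul1r expr0n subr0 scale1r => vE; rewrite [RHS]vE.
have -> : dot v (- e 1) = - dot v (e 1) by rewrite !coordE; ring.
by rewrite scaleNr opprK.
Qed.

Lemma dot_frame_coord e x y z : cartesian_frame e ->
  [/\ dot (frame_comb e x y z) (e 0) = x, dot (frame_comb e x y z) (e 1) = y &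
      dot (frame_comb e x y z) (e 2%:R) = z].
Proof.
move=> [oe _].
by rewrite /frame_comb; split; rewrite dotC !dotDr !dotZr !oe !eqE /=; ring.
Qed.

Local Notation den w := (1 + Re w ^+ 2 + Im w ^+ 2).

(** Inverse stereographic projection from the pole [e 2]. *)
Definition sphere_point e w : 'cV[R]_3 :=
  frame_comb e (2 * Re w / den w) (2 * Im w / den w)
    ((Re w ^+ 2 + Im w ^+ 2 - 1) / den w).

(** The components are the real parts of the three integrands
    [(1 - w^2) c / 2], [i (1 + w^2) c / 2] and [w c], for [c = F w]. *)
Definition weierstrass_tangent e w c : 'cV[R]_3 :=
  let: u +i* v := w in let: p +i* q := c in
  frame_comb e (((1 - u ^+ 2 + v ^+ 2) * p + 2 * u * v * q) / 2)
    (- (2 * u * v * p + (1 + u ^+ 2 - v ^+ 2) * q) / 2) (u * p - v * q).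

Lemma den_gt0 w : 0 < den w.
Proof. by rewrite -addrA ltr_pwDl// addr_ge0 ?sqr_ge0. Qed.

Lemma dot_sphere_point e w :
  cartesian_frame e -> dot (sphere_point e w) (sphere_point e w) = 1.
Proof.
move=> fe; rewrite dot_frame_comb//.
by field; rewrite gt_eqF ?den_gt0.
Qed.

(** The integrands form a null vector orthogonal to [sphere_point e w], so
    turning by a right angle in the tangent plane is multiplying [F w] by
    [i]. *)
Lemma cross_sphere_point e w c : cartesian_frame e ->
  cross (sphere_point e w) (weierstrass_tangent e w c) =
  weierstrass_tangent e w ('i * c).
Proof.
move=> fe; case: w (den_gt0 w) c => u v /= D0 [p q].
rewrite /sphere_point cross_frame_comb//.
have -> : 'i * (p +i* q) = (- q) +i* p by simpc.
rewrite /weierstrass_tangent /=.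
by congr (_ *: _ + _ *: _ + _ *: _); field; rewrite gt_eqF.
Qed.

Lemma dot_sphere_tangent e w c : cartesian_frame e ->
  dot (sphere_point e w) (weierstrass_tangent e w c) = 0.
Proof.
move=> fe; case: w (den_gt0 w) c => u v /= D0 [p q].
by rewrite dot_frame_comb//=; field; rewrite gt_eqF.
Qed.

Lemma weierstrass_tangent_neq0 e w c : cartesian_frame e -> c != 0 ->
  weierstrass_tangent e w c != 0.
Proof.
move=> fe; case: w (den_gt0 w) c => u v D0 [p q] c0.
set T := weierstrass_tangent _ _ _.
suff : dot T T != 0 by apply: contra_neq => ->; rewrite dot0r.
rewrite /T dot_frame_comb//.
(* the real part of a null vector carries half of its squared Hermitian norm *)
set X := (X in X != 0).
have -> : X = (1 + u ^+ 2 + v ^+ 2) ^+ 2 * (p ^+ 2 + q ^+ 2) / 4.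
  by rewrite /X; field.
rewrite !mulf_neq0 ?expf_neq0 ?(gt_eqF D0)//.
rewrite paddr_eq0 ?sqr_ge0// !sqrf_eq0.
by move: c0; rewrite eq_complex.
Qed.

Lemma weierstrass_frame e w c : cartesian_frame e -> c != 0 ->
  oriented_frame (sphere_point e w) (weierstrass_tangent e w c).
Proof.
move=> fe c0; split; [exact: dot_sphere_point|exact: dot_sphere_tangent|].
exact: weierstrass_tangent_neq0.
Qed.

Lemma weierstrass_tangentM e w c (s t : R) :
  weierstrass_tangent e w ((s +i* t) * c) =
  s *: weierstrass_tangent e w c + t *: weierstrass_tangent e w ('i * c).
Proof.
case: w c => u v [p q]; simpc => /=.
by rewrite /frame_comb; apply: col3P; rewrite !vecE; field.
Qed.

(** The partial derivatives are the real parts of the integrands and of [i]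
    times the integrands; [cross_sphere_point] identifies the second with
    [cross nu a]. *)
Lemma weierstrass_conformal e Omega F r w :
  open Omega -> cartesian_frame e -> weierstrass_representation e Omega F r ->
  Omega w -> F w != 0 ->
  conformal_at r w (sphere_point e w) (weierstrass_tangent e w (F w)).
Proof.
move=> oO fe [f1 [f2 [f3 rep]]] Ow Fw; split; first exact: weierstrass_frame.
have [d1 d2 d3 _] := rep w Ow.
pose g z := Re (f1 z) *: e 0 + Re (f2 z) *: e 1 + Re (f3 z) *: e 2%:R.
have diffZ (k : R[i] -> R) (x y : R) (v : 'cV[R]_3) :
    is_diff (xy w) (in_xy k) (planar x y) ->
    is_diff (xy w) (in_xy (fun z => k z *: v)) (planar (x *: v) (y *: v)).
  move=> dk; apply: DiffDef.
    exact: differentiableZl (ex_diff (is_diff_def := dk)).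
  rewrite (diffZl _ (ex_diff (is_diff_def := dk))) diff_val.
  by apply/funext => p; rewrite /planar scalerDl !scalerA.
have dg : is_diff (xy w) (in_xy g)
    (planar (weierstrass_tangent e w (F w))
       (cross (sphere_point e w) (weierstrass_tangent e w (F w)))).
  apply: is_diff_eq (is_diffD (is_diffD
    (diffZ _ _ _ (e 0) (is_derive_is_diff_Re d1))
    (diffZ _ _ _ (e 1) (is_derive_is_diff_Re d2)))
    (diffZ _ _ _ (e 2%:R) (is_derive_is_diff_Re d3))) _.
  apply/funext => p; rewrite !fctE cross_sphere_point//.
  have half : (2%:R^-1 : R[i]) = (2^-1)%:C by rewrite fmorphV rmorphMn.
  rewrite half; case: (w) => u v; case: (F _) => x y.
  rewrite /planar /weierstrass_tangent; simpc => /=.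
  rewrite !expr2; simpc => /=.
  by rewrite /frame_comb; apply: col3P; rewrite !vecE; field.
apply: is_diff_near dg.
have := @toC_cvg _ w _ (open_nbhs_nbhs (conj oO Ow)).
move/(@filterS _ (nbhs (xy w))); apply => p Op; rewrite /in_xy.
by have [_ _ _ ->] := rep _ Op.
Qed.

End Surfaces.

(** * C1 functions with prescribed partial derivatives *)

Section C1Calculus.
Variable R : realType.
Implicit Types (Omega : set R[i]) (phi psi pu pv : R[i] -> R).

(** Carrying the partial derivatives explicitly makes this class closed under
    the ring operations by the usual rules. *)
Definition C1_with Omega phi pu pv := forall w, Omega w ->
  [/\ is_diff (xy w) (in_xy phi) (planar (pu w) (pv w)),
      {for xy w, continuous (in_xy pu)} & {for xy w, continuous (in_xy pv)}].

Lemma C1_with_partial Omega phi pu pv w : C1_with Omega phi pu pv -> Omega w ->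
  partial_u phi w = pu w /\ partial_v phi w = pv w.
Proof.
move=> h /h[d _ _]; rewrite /partial_u /partial_v !deriveE// diff_val.
by rewrite /planar /= !scale1r !scale0r addr0 add0r.
Qed.

(** As [Omega] is open, the partial derivatives coincide with the prescribed
    functions in a neighbourhood, and inherit their continuity. *)
Lemma C1_with_on Omega phi pu pv :
  open Omega -> C1_with Omega phi pu pv -> C1_on Omega phi.
Proof.
move=> oO h w Ow; have [d cu cv] := h w Ow.
have nearO : \forall p \near xy w, Omega (toC p).
  exact: (@toC_cvg _ w _ (open_nbhs_nbhs (conj oO Ow))).
have E k k' : {for xy w, continuous (in_xy k)} ->
    (forall z, Omega z -> k' z = k z) -> {for xy w, continuous (in_xy k')}.
  move=> ck kk'; rewrite /prop_for /continuous_at.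
  have -> : in_xy k' (xy w) = in_xy k (xy w).
    by rewrite /in_xy; apply: kk'; rewrite -[X in Omega X]xyK in Ow *.
  apply: cvg_trans ck; apply: near_eq_cvg.
  by near=> p; rewrite /in_xy kk'//; near: p.
split; first exact: ex_diff.
  by apply: E cu _ => z /(C1_with_partial h)[].
by apply: E cv _ => z /(C1_with_partial h)[].
Unshelve. all: by end_near. Qed.

Lemma C1_with_continuous Omega phi pu pv w :
  C1_with Omega phi pu pv -> Omega w -> {for xy w, continuous (in_xy phi)}.
Proof. by move=> h /h[d _ _]; apply: differentiable_continuous. Qed.

Lemma C1_with_eq Omega phi pu pv phi' pu' pv' :
  C1_with Omega phi pu pv -> phi =1 phi' -> pu =1 pu' -> pv =1 pv' ->
  C1_with Omega phi' pu' pv'.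
Proof. by move=> h /funext <- /funext <- /funext <-. Qed.

Lemma C1_with_cst Omega (k : R) : C1_with Omega (cst k) (cst 0) (cst 0).
Proof.
move=> w _; split; [|exact: cst_continuous|exact: cst_continuous].
apply: is_diff_eq (is_diff_cst k (xy w)) _.
by apply/funext => p; rewrite /planar !scaler0 addr0.
Qed.

Lemma C1_with_Re Omega : C1_with Omega (@complex.Re R) (cst 1) (cst 0).
Proof.
move=> w _; split; [|exact: cst_continuous|exact: cst_continuous].
have -> : in_xy (@complex.Re R) = planar (1 : R) (0 : R).
  by apply/funext => p; rewrite /planar scaler0 addr0 [_ *: _]mulr1.
apply: DiffDef; first exact/linear_differentiable/planar_continuous.
by rewrite diff_lin//; exact: planar_continuous.
Qed.

Lemma C1_with_Im Omega : C1_with Omega (@complex.Im R) (cst 0) (cst 1).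
Proof.
move=> w _; split; [|exact: cst_continuous|exact: cst_continuous].
have -> : in_xy (@complex.Im R) = planar (0 : R) (1 : R).
  by apply/funext => p; rewrite /planar scaler0 add0r [_ *: _]mulr1.
apply: DiffDef; first exact/linear_differentiable/planar_continuous.
by rewrite diff_lin//; exact: planar_continuous.
Qed.

Lemma C1_withD Omega phi pu pv psi qu qv :
  C1_with Omega phi pu pv -> C1_with Omega psi qu qv ->
  C1_with Omega (phi \+ psi) (pu \+ qu) (pv \+ qv).
Proof.
move=> h k w Ow; have [d cu cv] := h w Ow; have [d' cu' cv'] := k w Ow.
split; [|exact: continuousD cu cu'|exact: continuousD cv cv'].
apply: is_diff_eq (is_diffD d d') _.
by apply/funext => p; rewrite fctE /planar !scalerDr addrACA.
Qed.

Lemma C1_withM Omega phi pu pv psi qu qv :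
  C1_with Omega phi pu pv -> C1_with Omega psi qu qv ->
  C1_with Omega (phi \* psi) (phi \* qu \+ psi \* pu) (phi \* qv \+ psi \* pv).
Proof.
move=> h k w Ow; have [d cu cv] := h w Ow; have [d' cu' cv'] := k w Ow.
have c := C1_with_continuous h Ow; have c' := C1_with_continuous k Ow.
split; [|exact: continuousD (continuousM c cu') (continuousM c' cu)|
  exact: continuousD (continuousM c cv') (continuousM c' cv)].
apply: is_diff_eq (is_diffM d d') _.
apply/funext => p; rewrite fctE /planar /in_xy [_ +i* _]xyK.
rewrite /GRing.scale /= -[phi w *: _]/(phi w * _) -[psi w *: _]/(psi w * _).
ring.
Qed.

Lemma C1_withV Omega phi pu pv :
  C1_with Omega phi pu pv -> (forall w, Omega w -> phi w != 0) ->
  C1_with Omega (fun w => (phi w)^-1) (fun w => - (phi w) ^- 2 * pu w)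
    (fun w => - (phi w) ^- 2 * pv w).
Proof.
move=> h p0 w Ow; have [d cu cv] := h w Ow.
have c := C1_with_continuous h Ow.
have pw0 : in_xy phi (xy w) != 0 by rewrite /in_xy [_ +i* _]xyK p0.
have cV : {for xy w, continuous (in_xy (fun w => - (phi w) ^- 2))}.
  apply: continuousN; apply: (@continuousV _ _ (fun p => in_xy phi p ^+ 2)).
    by rewrite expf_neq0.
  exact: (continuousM c c).
split; [|exact: continuousM cV cu|exact: continuousM cV cv].
apply: DiffDef; first exact: differentiableV (ex_diff (is_diff_def := d)) pw0.
rewrite (diffV (ex_diff (is_diff_def := d)) pw0) diff_val.
apply/funext => p; rewrite /planar /in_xy [_ +i* _]xyK.
rewrite -[LHS]/(- phi w ^- 2 * (p.1 * pu w + p.2 * pv w)).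
set k := - phi w ^- 2; rewrite -[RHS]/(p.1 * (k * pu w) + p.2 * (k * pv w)).
ring.
Qed.

(** * The change of stereographic coordinates *)

Implicit Types (e : 'I_3 -> 'cV[R]_3) (v nu : 'cV[R]_3).

Local Notation den w := (1 + Re w ^+ 2 + Im w ^+ 2).

(** [sphere_du e] and [sphere_dv e] are the partial derivatives of
    [sphere_point e]. *)
Definition sphere_du e w : 'cV[R]_3 :=
  frame_comb e ((2 * den w - 4 * Re w ^+ 2) / den w ^+ 2)
    (- (4 * Re w * Im w) / den w ^+ 2) (4 * Re w / den w ^+ 2).

Definition sphere_dv e w : 'cV[R]_3 :=
  frame_comb e (- (4 * Re w * Im w) / den w ^+ 2)
    ((2 * den w - 4 * Im w ^+ 2) / den w ^+ 2) (4 * Im w / den w ^+ 2).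

(** The sign is where orientation enters: stereographic projection, seen with
    the outward normal of the sphere, reverses orientation. *)
Lemma sphere_dvE e w : cartesian_frame e ->
  sphere_dv e w = - cross (sphere_point e w) (sphere_du e w).
Proof.
move=> fe; rewrite cross_frame_comb// -scaleN1r.
case: w (den_gt0 w) => u v /= D0.
rewrite /sphere_dv /frame_comb !scalerDr !scalerA /=.
by congr (_ *: _ + _ *: _ + _ *: _); field; rewrite gt_eqF.
Qed.

Lemma dot_sphere_du e w : cartesian_frame e ->
  dot (sphere_point e w) (sphere_du e w) = 0.
Proof.
move=> fe; rewrite dot_frame_comb//.
by case: w (den_gt0 w) => u v /= D0; field; rewrite gt_eqF.
Qed.

Lemma sphere_du_neq0 e w : cartesian_frame e -> sphere_du e w != 0.
Proof.
move=> fe.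
have h : dot (sphere_du e w) (sphere_du e w) = 4 / den w ^+ 2.
  rewrite dot_frame_comb//.
  by case: w (den_gt0 w) => u v /= D0; field; rewrite gt_eqF.
have : dot (sphere_du e w) (sphere_du e w) != 0.
  by rewrite h mulf_neq0// invr_neq0// expf_neq0// gt_eqF// den_gt0.
by apply: contra_neq => ->; rewrite dot0r.
Qed.

Lemma C1_with_sphere_coord Omega e v :
  C1_with Omega (fun w => dot (sphere_point e w) v)
    (fun w => dot (sphere_du e w) v) (fun w => dot (sphere_dv e w) v).
Proof.
have cst_ k := @C1_with_cst Omega k.
have re := @C1_with_Re Omega; have im := @C1_with_Im Omega.
have cden := C1_withD (C1_withD (cst_ 1) (C1_withM re re)) (C1_withM im im).
have numer := C1_withD (C1_withD (C1_withM (cst_ (2 * dot (e 0) v)) re)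
  (C1_withM (cst_ (2 * dot (e 1) v)) im)) (cst_ (- 2 * dot (e 2%:R) v)).
have dotf x y z : dot (frame_comb e x y z) v =
    x * dot (e 0) v + y * dot (e 1) v + z * dot (e 2%:R) v.
  by rewrite /frame_comb !coordE; ring.
(* the third coordinate is 1 - 2 / den w *)
apply: (C1_with_eq
  (C1_withD (C1_withM numer (C1_withV cden _)) (cst_ (dot (e 2%:R) v))))
  => [w|w|w|w];
  rewrite /= ?dotf -?expr2;
  case: w (den_gt0 w) => u t /= D0; rewrite ?gt_eqF//;
  by field; rewrite gt_eqF.
Qed.

(** Here [(X, Y, Z)] is a point of the unit sphere, [(Xu, Yu, Zu)] a tangent
    vector and [(Xv, Yv, Zv)] the opposite of the cross product of the two. The
    two equations are the Cauchy-Riemann equations of [(X + i Y) / (1 - Z)],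
    cleared of the denominator [(1 - Z)^2]. Each difference of the two sides is
    a combination of the two constraints, which the proof exhibits. *)
Lemma cauchy_riemann_stereo (X Y Z Xu Yu Zu : R) :
  X * X + Y * Y + Z * Z = 1 -> X * Xu + Y * Yu + Z * Zu = 0 ->
  let Xv := - (Y * Zu - Z * Yu) in let Yv := - (Z * Xu - X * Zu) in
  let Zv := - (X * Yu - Y * Xu) in
  [/\ Yv * (1 - Z) + Y * Zv = Xu * (1 - Z) + X * Zu,
      Xv * (1 - Z) + X * Zv = - (Yu * (1 - Z) + Y * Zu) &
      Z != 1 -> Xu * (1 - Z) + X * Zu = 0 -> Yu * (1 - Z) + Y * Zu = 0 ->
      [/\ Xu = 0, Yu = 0 & Zu = 0]].
Proof.
move=> n1 n0 /=; split.
- apply/eqP; rewrite -subr_eq0; apply/eqP.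
  transitivity (Xu * (X * X + Y * Y + Z * Z - 1)
    - X * (X * Xu + Y * Yu + Z * Zu)).
    ring.
  by rewrite n1 n0; ring.
- apply/eqP; rewrite -subr_eq0; apply/eqP.
  transitivity (- (Yu * (X * X + Y * Y + Z * Z - 1)
    - Y * (X * Xu + Y * Yu + Z * Zu))).
    ring.
  by rewrite n1 n0; ring.
move=> Z1 hX hY.
have sZ : 1 - Z != 0 by rewrite subr_eq0 eq_sym.
have Zu0 : Zu = 0.
  apply/eqP; rewrite -(mulIr_eq0 _ (mulIf sZ)); apply/eqP.
  transitivity (X * (Xu * (1 - Z) + X * Zu) + Y * (Yu * (1 - Z) + Y * Zu)
    - (1 - Z) * (X * Xu + Y * Yu + Z * Zu) - Zu * (X * X + Y * Y + Z * Z - 1)).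
    ring.
  by rewrite n1 n0 hX hY; ring.
move: hX hY; rewrite Zu0 !mulr0 !addr0 => /eqP hX /eqP hY.
move: hX hY; rewrite !mulf_eq0 !(negbTE sZ) !orbF => /eqP -> /eqP ->.
by [].
Qed.

End C1Calculus.

Section Transition.
Variable R : realType.
Implicit Types (Omega : set R[i]) (F : R[i] -> R[i]).
Implicit Types (e : 'I_3 -> 'cV[R]_3) (v nu : 'cV[R]_3).

Local Notation den w := (1 + Re w ^+ 2 + Im w ^+ 2).

(** Stereographic projection from the pole [e 2], in the frame [e]. *)
Definition stereo e v : R[i] :=
  (dot v (e 0) / (1 - dot v (e 2%:R))) +i* (dot v (e 1) / (1 - dot v (e 2%:R))).

Lemma sphere_point_top e w : cartesian_frame e ->
  dot (sphere_point e w) (e 2%:R) != 1.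
Proof.
move=> fe; have [_ _ ->] := dot_frame_coord
  (2 * Re w / den w) (2 * Im w / den w)
  ((Re w ^+ 2 + Im w ^+ 2 - 1) / den w) fe.
apply/eqP => E; have := congr1 ( *%R^~ (den w)) E.
by rewrite /= divfK ?lt0r_neq0 ?den_gt0// mul1r; lra.
Qed.

Lemma stereoK e w : cartesian_frame e -> stereo e (sphere_point e w) = w.
Proof.
move=> fe; rewrite /stereo; have := sphere_point_top w fe.
rewrite /sphere_point; set x := _ / _; set y := _ / _; set z := _ / _.
have [-> -> ->] := dot_frame_coord x y z fe => z1.
have {z1}: 1 - z != 0 by rewrite subr_eq0 eq_sym.
rewrite /x /y /z; case: w (den_gt0 w) {x y z} => u v /= D0 z1.
have zE : 1 - (u ^+ 2 + v ^+ 2 - 1) / (1 + u ^+ 2 + v ^+ 2) =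
    2 / (1 + u ^+ 2 + v ^+ 2).
  by field; rewrite gt_eqF.
by rewrite zE; congr (_ +i* _); field; rewrite gt_eqF.
Qed.

(** A Moebius transformation: the same unit normal, read in another frame. *)
Definition transition e e' (w : R[i]) := stereo e' (sphere_point e w).

(** Its complex derivative, by the quotient rule; [t] is the derivative of the
    normal [n]. *)
Definition transition_du e e' (w : R[i]) : R[i] :=
  let n := sphere_point e w in let t := sphere_du e w in
  let s := 1 - dot n (e' 2%:R) in
  ((dot t (e' 0) * s + dot n (e' 0) * dot t (e' 2%:R)) / s ^+ 2) +i*
  ((dot t (e' 1) * s + dot n (e' 1) * dot t (e' 2%:R)) / s ^+ 2).

(** The hypotheses of [cauchy_riemann_stereo], for the coordinates of the normal
    of one frame in the other. *)
Lemma sphere_coords e e' w : cartesian_frame e -> cartesian_frame e' ->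
  let n := sphere_point e w in let t := sphere_du e w in
  [/\ dot n (e' 0) * dot n (e' 0) + dot n (e' 1) * dot n (e' 1) +
      dot n (e' 2%:R) * dot n (e' 2%:R) = 1,
      dot n (e' 0) * dot t (e' 0) + dot n (e' 1) * dot t (e' 1) +
      dot n (e' 2%:R) * dot t (e' 2%:R) = 0 &
      [/\ dot (sphere_dv e w) (e' 0) =
        - (dot n (e' 1) * dot t (e' 2%:R) - dot n (e' 2%:R) * dot t (e' 1)),
      dot (sphere_dv e w) (e' 1) =
        - (dot n (e' 2%:R) * dot t (e' 0) - dot n (e' 0) * dot t (e' 2%:R)) &
      dot (sphere_dv e w) (e' 2%:R) =
        - (dot n (e' 0) * dot t (e' 1) - dot n (e' 1) * dot t (e' 0))]].
Proof.
move=> fe fe' n t; split.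
- by rewrite -(dot_frame_comb _ _ _ _ _ _ fe') frame_combK// dot_sphere_point.
- by rewrite -(dot_frame_comb _ _ _ _ _ _ fe') !frame_combK// dot_sphere_du.
rewrite sphere_dvE// -/n -/t.
have dotN a b : dot (- a) b = - dot a b :> R by rewrite !coordE; ring.
rewrite !dotN.
have -> : cross n t = cross
    (frame_comb e' (dot n (e' 0)) (dot n (e' 1)) (dot n (e' 2%:R)))
    (frame_comb e' (dot t (e' 0)) (dot t (e' 1)) (dot t (e' 2%:R))).
  by rewrite !frame_combK.
rewrite cross_frame_comb//.
set x := _ - _; set y := _ - _; set z := _ - _.
by have [-> -> ->] := dot_frame_coord x y z fe'.
Qed.

(** The partial derivatives [p + i q] and [- q + i p] say that [transition] is
    holomorphic. *)
Lemma transition_C1 Omega e e' : cartesian_frame e -> cartesian_frame e' ->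
  (forall w, Omega w -> dot (sphere_point e w) (e' 2%:R) != 1) ->
  C1_with Omega (fun w => Re (transition e e' w))
    (fun w => Re (transition_du e e' w))
    (fun w => - Im (transition_du e e' w)) /\
  C1_with Omega (fun w => Im (transition e e' w))
    (fun w => Im (transition_du e e' w))
    (fun w => Re (transition_du e e' w)).
Proof.
move=> fe fe' top; have coord := @C1_with_sphere_coord R Omega e.
pose s w := 1 - dot (sphere_point e w) (e' 2%:R).
have quotient k : C1_with Omega (fun w => dot (sphere_point e w) (e' k) / s w)
    (fun w => (dot (sphere_du e w) (e' k) * s w + dot (sphere_point e w) (e' k)
       * dot (sphere_du e w) (e' 2%:R)) / s w ^+ 2)
    (fun w => (dot (sphere_dv e w) (e' k) * s w + dot (sphere_point e w) (e' k)
       * dot (sphere_dv e w) (e' 2%:R)) / s w ^+ 2).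
  have cs := C1_withD (@C1_with_cst R Omega 1)
    (C1_withM (@C1_with_cst R Omega (- 1)) (coord (e' 2%:R))).
  have quotE (x c a b : R) :
      x * (- c ^- 2 * (0 + (- 1 * b + 0))) + c^-1 * a =
      (a * c + x * b) / c ^+ 2.
    (* with the inverse of 0 equal to 0 the identity holds at the pole too *)
    have [->|c0] := eqVneq c 0; last by field.
    by rewrite expr0n !invr0; ring.
  apply: (C1_with_eq (C1_withM (coord (e' k)) (C1_withV cs _))) => w /=.
  - by move/top; rewrite mulN1r subr_eq0 eq_sym.
  - by rewrite mulN1r.
  - by rewrite mulN1r mulr0 quotE.
  - by rewrite mulN1r mulr0 quotE.
split; [apply: C1_with_eq (quotient 0) _ _ _
       |apply: C1_with_eq (quotient 1) _ _ _] => w //=;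
  have [n1 n0 [v0 v1 v2]] := sphere_coords w fe fe';
  have [E1 E2 _] := cauchy_riemann_stereo n1 n0.
- by rewrite v0 v2 /s E2 mulNr.
- by rewrite v1 v2 /s E1.
Qed.

Lemma transition_du_neq0 e e' w : cartesian_frame e -> cartesian_frame e' ->
  dot (sphere_point e w) (e' 2%:R) != 1 -> transition_du e e' w != 0.
Proof.
move=> fe fe' top; have [n1 n0 _] := sphere_coords w fe fe'.
have s0 : 1 - dot (sphere_point e w) (e' 2%:R) != 0 by rewrite subr_eq0 eq_sym.
have [_ _ CR] := cauchy_riemann_stereo n1 n0.
apply: contra_neq (sphere_du_neq0 w fe) => /eqP.
rewrite eq_complex /= !mulf_eq0 !invr_eq0 !expf_eq0 /= (negbTE s0) !orbF.
move=> /andP[/eqP h0 /eqP h1]; have [t0 t1 t2] := CR top h0 h1.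
rewrite -(frame_combK (sphere_du e w) fe') t0 t1 t2 /frame_comb.
by rewrite !scale0r !addr0.
Qed.

(** Chain rule: a holomorphic change of parameter with derivative [d != 0] keeps
    the parametrization conformal with the same normal. *)
Lemma conformal_comp (rs : R[i] -> 'cV[R]_3) (h : R[i] -> R[i]) w (d : R[i])
    nu b :
  conformal_at rs (h w) nu b -> d != 0 ->
  is_diff (xy w) (in_xy (fun w => Re (h w))) (planar (Re d) (- Im d)) ->
  is_diff (xy w) (in_xy (fun w => Im (h w))) (planar (Im d) (Re d)) ->
  conformal_at (rs \o h) w nu (Re d *: b + Im d *: cross nu b).
Proof.
move=> [[n1 nb b0] drs] d0 dre dim; split.
  split=> //.
    by rewrite dotDr !dotZr nb dot_crossl !mulr0 addr0.
  apply/negP => /eqP B0.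
  have := congr1 (dot b) B0; have := congr1 (dot (cross nu b)) B0.
  rewrite !dotDr !dotZr !dot0r dot_cross_cross n1 nb mul1r expr0n subr0.
  rewrite (dotC (cross nu b) b) dot_crossr.
  rewrite !mulr0 addr0 add0r => /eqP + /eqP.
  rewrite !mulf_eq0 !(gt_eqF (dot_gt0 b0)) !orbF => im0 re0.
  by move: d0; rewrite eq_complex re0 im0.
pose hxy p := (in_xy (fun w => Re (h w)) p, in_xy (fun w => Im (h w)) p).
have -> : in_xy (rs \o h) = in_xy rs \o hxy.
  by apply/funext => p; rewrite /hxy /in_xy /=; case: (h _).
have drs' : is_diff (hxy (xy w)) (in_xy rs) (planar b (cross nu b)).
  by rewrite /hxy /in_xy [_ +i* _]xyK.
apply: is_diff_eq (is_diff_comp (is_diff_pair dre dim) drs') _.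
apply/funext => p; rewrite /planar /= crossDr !crossZr cross_cross nb n1.
by apply: col3P; rewrite !vecE /GRing.scale /=; ring.
Qed.

(** * Comparison of two surfaces *)

Lemma cexp_neq0 (z : R[i]) : cexp z != 0.
Proof.
rewrite /cexp eq_complex /= !mulf_eq0 gt_eqF ?expR_gt0//=.
apply/negP => /andP[/eqP c0 /eqP s0].
have := cos2Dsin2 (Im z); rewrite c0 s0 !expr0n /= addr0 => /eqP.
by rewrite eq_sym oner_eq0.
Qed.

(** The quotient [F* / F], in polar form. *)
Lemma cexp_ratio (a b c d : R) : cexp (c +i* d) =
  ((expR (c - a) * cos (d - b)) +i* (expR (c - a) * sin (d - b))) *
  cexp (a +i* b).
Proof.
rewrite -(subrK a c) -(subrK b d); move: (c - a) (d - b) => x y; rewrite !addrK.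
rewrite /cexp /= expRD cosD sinD; simpc.
by congr (_ +i* _); ring.
Qed.

(** The tangent vector of the representation is linear in [F w], with
    multiplication by [i] acting as [cross nu _]; multiplying [F w] by
    [F* / F] therefore scales and turns the tangent plane. *)
Lemma same_domain_gradient e Omega F Fs (Phi chi Phis chis : R[i] -> R) r rs w :
  open Omega -> cartesian_frame e ->
  weierstrass_representation e Omega F r ->
  weierstrass_representation e Omega Fs rs ->
  Omega w -> F w = cexp (Phi w +i* chi w) -> Fs w = cexp (Phis w +i* chis w) ->
  exists nu a b, [/\ conformal_at r w nu a, conformal_at rs w nu b &
   b = expR (Phis w - Phi w) * cos (chis w - chi w) *: a +
        expR (Phis w - Phi w) * sin (chis w - chi w) *: cross nu a].
Proof.
move=> oO fe rF rFs Ow FE FsE.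
exists (sphere_point e w), (weierstrass_tangent e w (F w)),
  (weierstrass_tangent e w (Fs w)).
split.
- by apply: (weierstrass_conformal oO fe rF Ow); rewrite FE cexp_neq0.
- by apply: (weierstrass_conformal oO fe rFs Ow); rewrite FsE cexp_neq0.
rewrite cross_sphere_point// -weierstrass_tangentM FE FsE.
congr weierstrass_tangent; exact: cexp_ratio.
Qed.

End Transition.

Theorem mainTheorem2 (R : realType) :
  (forall (Omega : set R[i]) (F Fs : R[i] -> R[i])
          (Phi chi Phis chis : R[i] -> R)
          (e : 'I_3 -> 'cV[R]_3) (r rs : R[i] -> 'cV[R]_3),
     open Omega -> simply_connected Omega ->
     holomorphic_on Omega F -> holomorphic_on Omega Fs ->
     harmonic_on Omega Phi -> harmonic_on Omega chi ->
     harmonic_on Omega Phis -> harmonic_on Omega chis ->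
     (forall w, Omega w -> F w = cexp (Phi w +i* chi w)) ->
     (forall w, Omega w -> Fs w = cexp (Phis w +i* chis w)) ->
     cartesian_frame e ->
     weierstrass_representation e Omega F r ->
     weierstrass_representation e Omega Fs rs ->
     [/\ forall w, Omega w -> unit_normal rs w = unit_normal r w,
         bending_neutral Omega r rs &
         forall w, Omega w ->
           is_surface_gradient r rs w
             (expR (Phis w - Phi w) *:
                (axis_rotation (unit_normal r w) (chis w - chi w) *m
                   tangent_proj (unit_normal r w)))])
  /\
  (forall (Omega Omegas : set R[i]) (r rs : R[i] -> 'cV[R]_3),
     weierstrass_surface Omega r -> weierstrass_surface Omegas rs ->
     spherical_image Omega r = spherical_image Omegas rs ->
     exists h : R[i] -> R[i],
       C1_diffeo Omega Omegas h /\ bending_neutral Omega r (rs \o h)).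
Proof.
split.
  move=> Omega F Fs Phi chi Phis chis e r rs oO _ _ _ _ _ _ _ FE FsE fe rF rFs.
  have H w (Ow : Omega w) :=
    same_domain_gradient oO fe rF rFs Ow (FE w Ow) (FsE w Ow).
  split=> [w /H [nu [a [b [cr crs _]]]]| |w /H [nu [a [b [cr crs bE]]]]].
  - by rewrite (unit_normal_conformal cr) (unit_normal_conformal crs).
  - apply: bending_neutral_conformal => w /H [nu [a [b [cr crs _]]]].
    by exists nu, a, b.
  - rewrite (unit_normal_conformal cr) bE in crs *.
    exact: surface_gradient_conformal cr crs.
move=> Omega Omegas r rs [oO _ [e [F [fe _ F0 rF]]]].
move=> [oOs _ [es [Fs [fes _ Fs0 rFs]]]] img.
have cr w (Ow : Omega w) := weierstrass_conformal oO fe rF Ow (F0 w Ow).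
have crs w (Ow : Omegas w) := weierstrass_conformal oOs fes rFs Ow (Fs0 w Ow).
have imgE : sphere_point e @` Omega = sphere_point es @` Omegas.
  rewrite -(eq_imagel (fun w Ow => unit_normal_conformal (cr w Ow))).
  by rewrite -(eq_imagel (fun w Ow => unit_normal_conformal (crs w Ow))).
(* parameters of the two surfaces with the same unit normal *)
have match_r w : Omega w ->
    exists2 z, Omegas z & sphere_point es z = sphere_point e w.
  move=> Ow; have : (sphere_point e @` Omega) (sphere_point e w) by exists w.
  by rewrite imgE.
have match_l z : Omegas z ->
    exists2 w, Omega w & sphere_point e w = sphere_point es z.
  move=> Oz; have : (sphere_point es @` Omegas) (sphere_point es z) by exists z.
  by rewrite -imgE.
have avoid w : Omega w -> dot (sphere_point e w) (es 2%:R) != 1.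
  by move=> /match_r[z _ <-]; exact: sphere_point_top.
have avoids z : Omegas z -> dot (sphere_point es z) (e 2%:R) != 1.
  by move=> /match_l[w _ <-]; exact: sphere_point_top.
have [Ch1 Ch2] := transition_C1 fe fes avoid.
have [Ck1 Ck2] := transition_C1 fes fe avoids.
exists (transition e es); split.
  exists (transition es e); split.
  - move=> w Ow; have [z Oz zE] := match_r w Ow.
    have -> : transition e es w = z by rewrite /transition -zE stereoK.
    split; first exact: Oz.
    by rewrite /transition zE stereoK.
  - move=> z Oz; have [w Ow wE] := match_l z Oz.
    have -> : transition es e z = w by rewrite /transition -wE stereoK.
    split; first exact: Ow.
    by rewrite /transition wE stereoK.
  - by split; [exact: C1_with_on Ch1|exact: C1_with_on Ch2].
  - by split; [exact: C1_with_on Ck1|exact: C1_with_on Ck2].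
apply: bending_neutral_conformal => w Ow; have [z Oz zE] := match_r w Ow.
have hE : transition e es w = z by rewrite /transition -zE stereoK.
have [dre _ _] := Ch1 w Ow; have [dim _ _] := Ch2 w Ow.
exists (sphere_point e w); do 2!eexists; split; first exact: cr.
apply: conformal_comp dre dim; last exact: transition_du_neq0 (avoid w Ow).
by rewrite hE -zE; exact: crs.
Qed.
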